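(* Let $t_0,x_0\in\mathbb{R}$. Assume that $F_1,F_2:\mathbb{R}\to\mathbb{R}$ are continuous functions and that $|F_1|$ and $|F_2|$ are bounded by $\beta<\infty$. If $\{B_t,t\in\mathbb{R}\}$ is a continuous real-valued process, then the equation $$\frac{dX_t}{dt}=\begin{cases}F_1(X_t)&\text{if }X_t>B_t,\\ F_2(X_t)&\text{if }X_t<B_t,\end{cases}\qquad t\in\mathbb{R},\qquad X(t_0)=x_0,$$ has a Lipschitz solution, a.s. There exists a maximal Lipschitz solution $\{X_t^+,t\ge t_0\}$ to this equation; it is adapted to the filtration $\mathcal F_t=\sigma(B_s,s\in[t_0,t])$.
   Context: A solution is a function $t\mapsto X_t$ with $X_{t_0}=x_0$ for which the displayed derivative condition holds at every $t$ with $X_t\neq B_t$; nothing is required of the derivative at times $t$ with $X_t=B_t$. A Lipschitz solution is a solution that is a Lipschitz function of $t$. Maximal means largest among Lipschitz solutions: $X^+_t\ge X^*_t$ for all $t\ge t_0$ for every other Lipschitz solution $X^*$.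
   Formalization: For each K ≥ β the maximal solution is K-Lipschitz and largest among K-Lipschitz solutions, not among all Lipschitz ones: with F1=F2=0, B_t=t², t0=x0=0, the solutions min(t²,n²) have no Lipschitz upper bound. *)

(* Defs.v *)
From mathcomp Require Import all_boot all_order all_algebra.
From mathcomp Require Import all_classical all_reals all_analysis.

Set Implicit Arguments.
Unset Strict Implicit.
Unset Printing Implicit Defensive.

Import Order.TTheory GRing.Theory Num.Theory.
Import numFieldNormedType.Exports.

Local Open Scope classical_set_scope.
Local Open Scope ring_scope.

(* Derivative of [X] at [t] relative to the time domain [D]: the two-sided
   derivative when [D] is a neighbourhood of [t] (see [deriv_withinT]), and the
   right derivative when [t] is the left endpoint of [D]. *)
Definition deriv_within (R : realType) (D : set R) (X : R -> R) (t l : R) :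
    Prop :=
  (fun h : R => h^-1 *: (X (h + t) - X t))
    @ within [set h | D (h + t)] (0 : R)^' --> l.

Lemma deriv_withinT (R : realType) (X : R -> R) (t l : R) :
  deriv_within setT X t l <-> is_derive t 1 X l.
Proof.
have E : (fun h : R => h^-1 *: (X (h + t) - X t))
       = (fun h : R => h^-1 *: (X (h *: (1 : R) + t) - X t)).
  by apply/funext => h; rewrite [h *: 1]mulr1.
rewrite /deriv_within E.
have -> : within [set h : R | setT (h + t)] (0 : R)^' = (0 : R)^'.
  apply/seteqP; split => A; rewrite /within /=.
    by apply: filterS => h; apply.
  by apply: filterS => h Ah _.
split=> [cX | dX].
  have dX : derivable X t 1 by apply/cvg_ex; exists l.
  by apply: DeriveDef => //; apply: cvg_lim cX.
have := @ex_derive _ _ _ _ _ _ _ dX.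
by rewrite -(@derive_val _ _ _ _ _ _ _ dX).
Qed.

(* Nothing is required of the derivative at the times [t] with [X t = b t]. *)
Definition is_solution (R : realType) (F1 F2 b : R -> R) (t0 x0 : R)
    (D : set R) (X : R -> R) : Prop :=
  X t0 = x0 /\
  forall t, D t ->
    (b t < X t -> deriv_within D X t (F1 (X t))) /\
    (X t < b t -> deriv_within D X t (F2 (X t))).

Definition is_lipschitz_solution (R : realType) (F1 F2 b : R -> R)
    (t0 x0 : R) (D : set R) (K : R) (X : R -> R) : Prop :=
  is_solution F1 F2 b t0 x0 D X /\ K.-lipschitz_D X.

(* The Lipschitz constant [K] has to be common to [X] and its competitors.
   With F1 = F2 = 0, b t = t ^ 2 and t0 = x0 = 0, each min(t ^ 2, n ^ 2) is a
   Lipschitz solution on [0, +oo[, but no Lipschitz function dominates all of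
   them, so there is no largest solution among those with arbitrary constants.
   Off the times where X = b, the equation itself forces slopes at most beta. *)
Definition is_maximal_lipschitz_solution (R : realType) (F1 F2 b : R -> R)
    (t0 x0 K : R) (X : R -> R) : Prop :=
  is_lipschitz_solution F1 F2 b t0 x0 `[t0, +oo[ K X /\
  forall Y : R -> R, is_lipschitz_solution F1 F2 b t0 x0 `[t0, +oo[ K Y ->
    forall t, t0 <= t -> Y t <= X t.

(* sigma(B_s, s in [t0, t]), not completed by the null sets. *)
Definition natural_filtration d (R : realType) (T : measurableType d)
    (B : R -> T -> R) (t0 t : R) : set (set T) :=
  <<s \bigcup_(s in `[t0, t]) preimage_set_system setT (B s) measurable >>.

Definition adapted_from (R : realType) (T : Type) (t0 : R)
    (F : R -> set (set T)) (X : R -> T -> R) : Prop :=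
  forall t, t0 <= t ->
  forall U : set R, measurable U -> F t (X t @^-1` U).

(* Main.v *)
Require Import Defs.
From mathcomp Require Import all_boot all_order all_algebra.
From mathcomp Require Import all_classical all_reals all_analysis.
From mathcomp Require Import measurable_realfun zify lra.

(* For a continuous path [b], run the Euler scheme with step [h] in which the
   slope at [(t, x)] is [F1 x + d] if [x > b t + d], [F2 x + d] if
   [x < b t - d] (both capped at [K]), and [K] in the band in between.  For
   fixed [d] and [h] small, the scheme stays above every [K]-Lipschitz
   solution: its slope dominates every slope that such a solution can have
   nearby.  So does the iterated limit [limsup_(d -> 0) limsup_(h -> 0)], and
   this limit is itself a [K]-Lipschitz solution: wherever its graph is off the
   graph of [b], nearby slopes of the scheme are squeezed around [F1] or [F2],
   and one-sided bounds on the slopes, both upper and lower, pass to a limsup.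
   It is therefore the maximal solution.  The scheme up to time [t] only reads
   [b] at finitely many times in [[t0, t]], whence adaptedness.  Solutions
   before [t0] are obtained by time reversal. *)

Set Implicit Arguments.
Unset Strict Implicit.
Unset Printing Implicit Defensive.

Import Order.TTheory GRing.Theory Num.Theory.
Import numFieldNormedType.Exports.

Local Open Scope classical_set_scope.
Local Open Scope ring_scope.

(** * Derivatives in increment form and uniform continuity *)

Lemma deriv_withinP (R : realType) (D : set R) (X : R -> R) (t l : R) :
  deriv_within D X t l <->
  forall e : R, 0 < e -> exists2 eta : R, 0 < eta & forall s, D s ->
    `|s - t| < eta ->
    `|X s - X t - l * (s - t)| <= e * `|s - t|.
Proof.
split=> [/cvgrPdist_le cX e e0|H].
  have := cX e e0; rewrite near_withinE near_withinE.
  move=> /nbhs_ballP[eta /= eta0 He].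
  exists eta => // s Ds; have [->|st sd] := eqVneq s t.
    by rewrite !subrr mulr0 subr0 normr0 mulr0.
  have h0 : s - t != 0 by rewrite subr_eq0.
  have := He (s - t); rewrite /ball /= sub0r normrN subrK => /(_ sd h0 Ds).
  rewrite -(ler_pM2r (x := `|s - t|)) ?normr_gt0// -normrM mulrBl.
  by rewrite /GRing.scale/= mulrAC mulVf// mul1r distrC.
apply/cvgrPdist_le => e e0; have [eta eta0 He] := H e e0.
rewrite near_withinE near_withinE; apply/nbhs_ballP; exists eta => //= h.
rewrite /ball /= sub0r normrN => hd h0 Dh.
have := He _ Dh; rewrite addrK => /(_ hd) He'.
rewrite -(ler_pM2r (x := `|h|)) ?normr_gt0// -normrM mulrBl.
by rewrite /GRing.scale/= mulrAC mulVf// mul1r distrC.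
Qed.

(** Half-radius balls and compactness of the segment. Only [x] is confined to [[a, b]]: in the
    comparison below the scheme stays in a known interval, while the nearby competitor value [y] may
    leave it. *)
Lemma continuous_unif (R : realType) (f : R -> R) (a b e : R) :
  continuous f -> 0 < e -> exists2 d : R, 0 < d & forall x y : R, a <= x <= b ->
    `|x - y| < d -> `|f x - f y| < e.
Proof.
move=> cf e0; have /compact_near_coveringP cpt := @segment_compact R a b.
pose P (d x : R) := forall y, `|x - y| < d -> `|f x - f y| < e.
have : \forall d \near (0 : R)^'+, `[a, b]%classic `<=` P d.
  apply: cpt => x _.
  have /cvgrPdist_lt/(_ (e / 2)) := cf x; rewrite divr_gt0// => /(_ isT).
  case/nbhs_ballP => r /= r0 Hr.
  exists (ball x (r / 2), [set d | d < r / 2]).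
    split=> /=; first by apply: nbhsx_ballx; rewrite divr_gt0.
    by apply: nbhs_right_lt; rewrite divr_gt0.
  move=> [x' d] [/= x'x dr] y x'y.
  have h1 : `|f x - f x'| < e / 2.
    by apply: Hr; apply: le_ball x'x; lra.
  have h2 : `|f x - f y| < e / 2.
    apply: Hr; rewrite /ball /= -(subrKA x').
    by apply: le_lt_trans (ler_normD _ _) _; rewrite /ball /= in x'x; lra.
  rewrite -(subrKA (f x)); apply: le_lt_trans (ler_normD _ _) _.
  by rewrite distrC; lra.
move=> HP; near (0 : R)^'+ => d.
exists d => // x y xab; apply: (near HP d) => //.
Unshelve. all: by end_near. Qed.

(** * Growth of discrete paths with locally bounded slopes *)

Section Polygon.
Context {R : realType}.
Implicit Types (x : nat -> R) (h K M c rho : R).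

(* Below [c - rho] the line of slope [M] is out of reach, so that the bound on
   the increments is only needed near [c]. *)
Lemma polygon_le x h K M c rho p : 0 <= h -> 0 <= K ->
  (forall k, (k < p)%N -> x k.+1 - x k <= K * h) ->
  (K + `|M|) * (h * p%:R) <= rho ->
  (forall k, (k < p)%N -> `|x k - c| <= rho -> x k.+1 - x k <= M * h) ->
  x 0%N <= c -> x p <= c + M * (h * p%:R).
Proof.
move=> h0 K0 xK hrho xM x0; pose N : R := `|M|; rewrite -/N in hrho.
suff H k : (k <= p)%N -> x k <= c + M * (h * k%:R).
  exact: H.
elim: k => [|k IH] kp; first by rewrite !mulr0 addr0.
have {IH} := IH (ltnW kp); have := xK _ kp; have := xM _ kp.
rewrite -natr1.
have : 0 <= k%:R :> R by [].
have : k%:R + 1 <= p%:R :> R by rewrite natr1 ler_nat.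
have : - N <= M <= N by rewrite -ler_norml.
move: N (k%:R) (p%:R) hrho (x k) (x k.+1) => N k' p' hrho y z.
move=> /andP[M1 M2] kp' k0 H1 H2 H3.
have u0 : 0 <= h * k' by rewrite mulr_ge0.
have uv : h * (k' + 1) <= h * p' by rewrite ler_wpM2l.
have N0 : 0 <= N by lra.
have := ler_wpM2l N0 uv; have := ler_wpM2l K0 uv.
have := ler_wpM2r u0 M1; have := ler_wpM2r u0 M2.
have := ler_wpM2r h0 M1; have := ler_wpM2r h0 M2.
have := mulr_ge0 K0 u0; have := mulr_ge0 N0 u0; have := mulr_ge0 N0 h0.
have := mulr_ge0 K0 h0.
(* Off the window, a value above [c + rho] is excluded by the bound at step [k], and from below
   [c - rho] a step of at most [K * h] stays under the line. *)
have [/H1|] := leP `|y - c| rho; first by lra.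
by case: ler0P => *; lra.
Qed.

Lemma polygon_ge x h K M c rho p : 0 <= h -> 0 <= K ->
  (forall k, (k < p)%N -> - (K * h) <= x k.+1 - x k) ->
  (K + `|M|) * (h * p%:R) <= rho ->
  (forall k, (k < p)%N -> `|x k - c| <= rho -> M * h <= x k.+1 - x k) ->
  c <= x 0%N -> c + M * (h * p%:R) <= x p.
Proof.
move=> h0 K0 xK hrho xM x0.
rewrite -lerN2 opprD -mulNr.
apply: (@polygon_le (fun k => - x k) h K (- M) (- c) rho) => //=.
- by move=> k kp; have := xK _ kp; lra.
- by rewrite normrN.
- by move=> k kp; rewrite -opprD normrN => /(xM _ kp); lra.
- by rewrite lerN2.
Qed.

End Polygon.

(** * The Euler scheme for a general bounded slope [g] *)

Section Euler.
Context {R : realType}.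
Variables (g : R -> R -> R) (b : R -> R) (t0 x0 K : R).
Hypothesis g_bnd : forall y x, `|g y x| <= K.

Let K0 : 0 <= K := le_trans (normr_ge0 _) (g_bnd 0 0).

Fixpoint euler (h : R) (k : nat) : R :=
  if k is k'.+1 then
    euler h k' + g (b (t0 + h * k'%:R)) (euler h k') * h
  else x0.

Definition grid_index (n : nat) (t : R) : nat :=
  Num.truncn ((t - t0) * n.+1%:R).

(** The value is held constant between grid points instead of being interpolated: this costs errors
    of order [h], but the value at [t] then reads [b] only at grid times up to [t]. *)
Definition euler_at (n : nat) (t : R) : R := euler n.+1%:R^-1 (grid_index n t).

Lemma grid_index_itv n t : t0 <= t ->
  t0 + n.+1%:R^-1 * (grid_index n t)%:R <= t
    < t0 + n.+1%:R^-1 * (grid_index n t)%:R + n.+1%:R^-1.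
Proof.
move=> t0t; have : 0 <= (t - t0) * n.+1%:R by rewrite mulr_ge0// subr_ge0.
move/truncn_itv; rewrite -/(grid_index n t) -[(grid_index n t).+1%:R]natr1.
have q0 : 0 < n.+1%:R^-1 :> R by rewrite invr_gt0.
rewrite -(ler_pM2l q0) -(ltr_pM2l q0) mulrDr mulr1 mulrCA mulVf// mulr1.
move: (n.+1%:R^-1 : R) ((grid_index n t)%:R : R) => u v.
by move=> /andP[? ?]; apply/andP; split; lra.
Qed.

Lemma grid_index_le n r s : r <= s -> (grid_index n r <= grid_index n s)%N.
Proof. by move=> rs; apply: le_truncn; rewrite ler_wpM2r// lerB. Qed.

Lemma euler_step h k : 0 <= h -> `|euler h k.+1 - euler h k| <= K * h.
Proof.
by move=> h0; rewrite /= addrAC subrr add0r normrM [`|h|]ger0_norm// ler_wpM2r.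
Qed.

Section Increment.
Variables (n : nat) (r s M c rho : R).
Let h : R := n.+1%:R^-1.
Hypotheses (t0r : t0 <= r) (rs : r <= s).
Hypothesis small : (K + `|M|) * (s - r + h) <= rho.

Let i := grid_index n r.
Let p := (grid_index n s - i)%N.

Let h0 : 0 < h. Proof. by rewrite /h invr_gt0. Qed.

Let hp : `|h * p%:R - (s - r)| <= h.
Proof.
have /andP[r1 r2] := grid_index_itv n t0r.
have /andP[s1 s2] := grid_index_itv n (le_trans t0r rs).
rewrite natrB ?grid_index_le// -/i -/h mulrBr.
move: r1 r2 s1 s2; rewrite -/i -/h.
by rewrite ler_norml => *; apply/andP; split; lra.
Qed.

Let hp_small : (K + `|M|) * (h * p%:R) <= rho.
Proof.
apply: le_trans small; rewrite ler_wpM2l ?addr_ge0//.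
by move: hp; rewrite ler_norml => /andP[]; lra.
Qed.

Let grid k : (k < p)%N ->
  t0 <= t0 + h * (i + k)%:R /\ r - h <= t0 + h * (i + k)%:R <= s.
Proof.
move=> kp.
have /andP[r1 r2] := grid_index_itv n t0r.
have /andP[s1 s2] := grid_index_itv n (le_trans t0r rs).
have ik : (i + k <= grid_index n s)%N by rewrite /p in kp; lia.
split; first by rewrite lerDl mulr_ge0// ltW.
move: r1 r2 s1 s2; rewrite -/h -/i => r1 r2 s1 s2.
have : h * (i + k)%:R <= h * (grid_index n s)%:R.
  by rewrite ler_wpM2l// ?ler_nat// ltW.
have : h * i%:R <= h * (i + k)%:R.
  by rewrite ler_wpM2l// ?ler_nat ?leq_addr// ltW.
by move=> *; apply/andP; split; lra.
Qed.

Let endp : (i + p)%N = grid_index n s.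
Proof. by rewrite /p subnKC// grid_index_le. Qed.

Let errM : `|M * (h * p%:R) - M * (s - r)| <= `|M| * h.
Proof. by rewrite -mulrBr normrM ler_wpM2l. Qed.

(** Reduces to [polygon_le] on the grid points behind [[r, s]]. The first of them may precede [r] by
    up to one step, hence the window from [r - h]; the elapsed grid time differs from [s - r] by at
    most [h], hence the error [|M| * h]. *)
Lemma euler_at_le :
  (forall tau y, t0 <= tau -> r - h <= tau <= s -> `|y - c| <= rho ->
     g (b tau) y <= M) ->
  euler_at n r <= c -> euler_at n s <= c + M * (s - r) + `|M| * h.
Proof.
move=> gM rc; have : euler_at n s <= c + M * (h * p%:R).
  rewrite /euler_at -endp.
  apply: (@polygon_le _ (fun k => euler h (i + k)%N) h K M c rho) => //.
  - exact: ltW.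
  - move=> k kp; apply: le_trans (ler_norm _) _; rewrite addnS.
    by apply: euler_step; rewrite ltW.
  - move=> k kp yc; rewrite addnS /= addrAC subrr add0r.
    by apply: ler_wpM2r; [exact: ltW | have [? ?] := grid kp; apply: gM].
  - by rewrite addn0.
by move: errM; rewrite ler_norml => /andP[]; lra.
Qed.

Lemma euler_at_ge :
  (forall tau y, t0 <= tau -> r - h <= tau <= s -> `|y - c| <= rho ->
     M <= g (b tau) y) ->
  c <= euler_at n r -> c + M * (s - r) - `|M| * h <= euler_at n s.
Proof.
move=> gM rc; have : c + M * (h * p%:R) <= euler_at n s.
  rewrite /euler_at -endp.
  apply: (@polygon_ge _ (fun k => euler h (i + k)%N) h K M c rho) => //.
  - exact: ltW.
  - move=> k kp; rewrite addnS.
    have := @euler_step h (i + k) (ltW h0); rewrite ler_norml.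
    by case/andP.
  - move=> k kp yc; rewrite addnS /= addrAC subrr add0r.
    by apply: ler_wpM2r; [exact: ltW | have [? ?] := grid kp; apply: gM].
  - by rewrite addn0.
by move: errM; rewrite ler_norml => /andP[]; lra.
Qed.

End Increment.

Lemma euler_at_lip n r s : t0 <= r -> r <= s ->
  `|euler_at n s - euler_at n r| <= K * (s - r) + K * n.+1%:R^-1.
Proof.
move=> t0r rs; have gK y x : - K <= g y x <= K by rewrite -ler_norml.
(* The bounds [K] and [- K] hold everywhere, so any radius will do and [lexx] selects it. *)
have := @euler_at_le n r s K (euler_at n r) _ t0r rs (lexx _).
have := @euler_at_ge n r s (- K) (euler_at n r) _ t0r rs (lexx _).
rewrite normrN (ger0_norm K0) => H1 H2.
have {}H1 := H1 (fun tau y _ _ _ => proj1 (andP (gK _ _))) (lexx _).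
have {}H2 := H2 (fun tau y _ _ _ => proj2 (andP (gK _ _))) (lexx _).
move: H1 H2; rewrite ler_norml; move: (n.+1%:R^-1 : R) => h.
by move=> H1 H2; apply/andP; split; lra.
Qed.

Lemma euler_at_start n : euler_at n t0 = x0.
Proof. by rewrite /euler_at /grid_index subrr mul0r truncn0. Qed.

End Euler.

(** * Iterated upper limits *)

Lemma near_mul_natSinv_le (R : realType) (C e : R) : 0 < e ->
  \forall n \near \oo, C * n.+1%:R^-1 <= e.
Proof.
move=> e0; have q0 : 0 < e / (`|C| + 1) by rewrite divr_gt0// ltr_wpDl.
apply: filterS (near_infty_natSinv_lt (PosNum q0)) => n /= nq.
apply: le_trans (_ : `|C| * n.+1%:R^-1 <= _).
  by rewrite ler_wpM2r// ler_norm.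
rewrite ltr_pdivlMr ?ltr_wpDl// in nq; apply: le_trans (ltW nq).
by rewrite mulrC ler_wpM2l// lerDl.
Qed.

(** For a bounded family this is [limsup_m limsup_n], written as one infimum of eventual upper
    bounds so that the inner limit never appears. As [inf] has a default value, [L] below keeps the
    set bounded from below and [U] keeps it nonempty. *)
Definition dlimsup (R : realType) (u : nat -> nat -> R) : R :=
  inf [set a | \forall m \near \oo, \forall n \near \oo, u m n <= a].

Section Dlimsup.
Context {R : realType}.
Variables (u : nat -> nat -> R).

Lemma dlimsup_le (L a : R) : (forall m n, L <= u m n) ->
  (\forall m \near \oo, \forall n \near \oo, u m n <= a) -> dlimsup u <= a.
Proof.
move=> Lu ua; apply: ge_inf => //; exists L => c /filter_ex[m /filter_ex[n]].
exact: le_trans.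
Qed.

Lemma near_le_dlimsup (U a : R) : (forall m n, u m n <= U) -> dlimsup u < a ->
  \forall m \near \oo, \forall n \near \oo, u m n <= a.
Proof.
move=> uU /inf_lt[|c uc ca].
  by exists U; near=> m; near=> n.
apply: filterS uc => m; apply: filterS => n h; apply: le_trans h (ltW ca).
Unshelve. all: by end_near. Qed.

End Dlimsup.

(** * The upper limit of the schemes: increments and derivative *)

Section UpperLimit.
Context {R : realType}.
Variables (g : nat -> R -> R -> R) (b : R -> R) (t0 x0 K : R).
Hypothesis g_bnd : forall m y x, `|g m y x| <= K.

Let K0 : 0 <= K := le_trans (normr_ge0 _) (g_bnd 0 0 0).
Let E m n t := euler_at (g m) b t0 x0 n t.

Definition euler_limit (t : R) : R := dlimsup (fun m n => E m n t).
Local Notation Z := euler_limit.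

(** The bound is uniform in [m] and [n], as the lemmas on [dlimsup] require. The last [K] absorbs
    the mesh error, the mesh being at most 1. *)
Lemma euler_at_bnd m n t : t0 <= t -> `|E m n t - x0| <= K * (t - t0) + K.
Proof.
move=> t0t; have := euler_at_lip b x0 (g_bnd m) n (lexx t0) t0t.
rewrite euler_at_start => H; apply: le_trans H _; rewrite lerD2l.
by rewrite ler_piMr// invf_le1// ler1n.
Qed.

Let Ege t m n : t0 <= t -> x0 - (K * (t - t0) + K) <= E m n t.
Proof. by move/(@euler_at_bnd m n); rewrite ler_norml => /andP[]; lra. Qed.

Let Ele t m n : t0 <= t -> E m n t <= x0 + (K * (t - t0) + K).
Proof. by move/(@euler_at_bnd m n); rewrite ler_norml => /andP[]; lra. Qed.

Lemma euler_limit_start : Z t0 = x0.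
Proof.
have H m n : E m n t0 = x0 by rewrite /E euler_at_start.
apply/eqP; rewrite eq_le; apply/andP; split.
  apply: (@dlimsup_le _ _ x0) => [m n|]; first by rewrite H.
  by near=> m; near=> n; rewrite H.
apply/ler_addgt0Pr => e e0.
have Zlt : Z t0 < Z t0 + e by rewrite ltrDl.
have /filter_ex[m /filter_ex[n]] :=
  near_le_dlimsup (fun m n => @Ele t0 m n (lexx _)) Zlt.
by rewrite H.
Unshelve. all: by end_near. Qed.

Section Increment.
Variables (r s M rho : R).
Hypotheses (t0r : t0 <= r) (rs : r <= s).
Hypothesis small : (K + `|M|) * (s - r) < rho.

Let t0s : t0 <= s := le_trans t0r rs.

Let rho0 : 0 < rho.
Proof. by apply: le_lt_trans small; rewrite mulr_ge0 ?subr_ge0// addr_ge0. Qed.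

Let mesh (e : R) : 0 < e -> \forall n \near \oo,
  [/\ (K + `|M|) * (s - r + n.+1%:R^-1) <= rho, `|M| * n.+1%:R^-1 <= e
    & n.+1%:R^-1 <= rho].
Proof.
move=> e0; have d0 : 0 < rho - (K + `|M|) * (s - r) by rewrite subr_gt0.
have := near_mul_natSinv_le 1 rho0.
have := near_mul_natSinv_le `|M| e0.
have := near_mul_natSinv_le (K + `|M|) d0.
apply: filterS3 => n H1 H2; rewrite mul1r => H3; split=> //.
by rewrite mulrDr -lerBrDl.
Qed.

(** Eventually the schemes start at [r] below [c = Z r + e1], so [euler_at_le] applies to each of
    them. The radius [2 * rho] makes room for the shift [e1 <= rho] of the centre. *)
Lemma euler_limit_le :
  (\forall m \near \oo, forall tau y, t0 <= tau -> r - rho <= tau <= s ->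
     `|y - Z r| <= 2 * rho -> g m (b tau) y <= M) ->
  Z s <= Z r + M * (s - r).
Proof.
move=> gM; apply/ler_addgt0Pr => e e0.
have : exists e1 : R, [/\ 0 < e1, e1 <= e / 2 & e1 <= rho].
  exists (Num.min (e / 2) rho); rewrite lt_min rho0 divr_gt0//.
  by rewrite !ge_min !lexx orbT.
case=> e1 [e10 e1e e1rho].
have Zlt : Z r < Z r + e1 by rewrite ltrDl.
apply: (dlimsup_le (fun m n => Ege m n t0s)).
have e20 : 0 < e / 2 by lra.
move: gM (near_le_dlimsup (fun m n => @Ele r m n t0r) Zlt).
apply: filterS2 => m gM; move: (mesh e20).
apply: filterS2 => n [H1 H2 H3] Er.
have := euler_at_le (g_bnd m) t0r rs H1 _ Er.
rewrite -/(E m n s) => H; apply: le_trans (H _) _ => [tau y t0tau taurs yc|].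
  apply: gM => //.
    move: taurs => /andP[ta ->]; rewrite andbT; apply: le_trans ta.
    by rewrite lerD2l lerN2.
  by move: yc; rewrite !ler_norml => /andP[? ?]; apply/andP; split; lra.
by move: H2 e1e; move: (`|M| * _) => u; lra.
Qed.

(** An upper limit gives no eventual lower bound at [r], so the argument runs backwards in time:
    were [Z s] too small, the schemes would eventually be low at [s], hence by the lower slope bound
    low at [r], and [Z r] would lie below itself. *)
Lemma euler_limit_ge :
  (\forall m \near \oo, forall tau y, t0 <= tau -> r - rho <= tau <= s ->
     `|y - Z r| <= 2 * rho -> M <= g m (b tau) y) ->
  Z r + M * (s - r) <= Z s.
Proof.
move=> gM; rewrite leNgt; apply/negP => Zs.
(* A third of the gap leaves [2 * e] to spend: [e] for lowering the start at [r], and [e / 2] for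
   the mesh error. *)
have [e [e0 e_rho Zse]] : exists e : R, [/\ 0 < e, e <= rho &
    Z s < Z r + M * (s - r) - 2 * e].
  exists (Num.min ((Z r + M * (s - r) - Z s) / 3) rho).
  rewrite lt_min rho0 divr_gt0// ?subr_gt0// ge_min lexx orbT; split=> //.
  have : Num.min ((Z r + M * (s - r) - Z s) / 3) rho <=
    (Z r + M * (s - r) - Z s) / 3 by rewrite ge_min lexx.
  by lra.
have : Z r <= Z r - e; last by lra.
apply: (dlimsup_le (fun m n => Ege m n t0r)).
have e20 : 0 < e / 2 by lra.
move: gM (near_le_dlimsup (fun m n => @Ele s m n t0s) Zse).
apply: filterS2 => m gM; move: (mesh e20).
apply: filterS2 => n [H1 H2 H3] Es; rewrite leNgt; apply/negP => /ltW Er.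
have := euler_at_ge (g_bnd m) t0r rs H1 _ Er.
rewrite -/(E m n s) => H.
suff : Z r - e + M * (s - r) - `|M| * n.+1%:R^-1 <= E m n s.
  by move: H2 Es; move: (`|M| * _) => u; lra.
apply: H => tau y t0tau taurs yc.
apply: gM => //.
    move: taurs => /andP[ta ->]; rewrite andbT; apply: le_trans ta.
    by rewrite lerD2l lerN2.
by move: yc; rewrite !ler_norml => /andP[? ?]; apply/andP; split; lra.
Qed.

End Increment.

Lemma euler_limit_lip r s : t0 <= r -> r <= s ->
  `|Z s - Z r| <= K * (s - r).
Proof.
move=> t0r rs; have gK m y x : - K <= g m y x <= K by rewrite -ler_norml.
(* The slope bounds [K] and [- K] are global; adding 1 only makes the radius strictly large
   enough. *)
have ok : (K + `|K|) * (s - r) < (K + `|K|) * (s - r) + 1 by rewrite ltrDl.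
have H1 : Z s <= Z r + K * (s - r).
  by apply: (euler_limit_le t0r rs ok); near=> m => tau y *;
    case/andP: (gK m (b tau) y).
rewrite -normrN in ok.
have H2 : Z r + - K * (s - r) <= Z s.
  by apply: (euler_limit_ge t0r rs ok); near=> m => tau y *;
    case/andP: (gK m (b tau) y).
by rewrite ler_norml; apply/andP; split; lra.
Unshelve. all: by end_near. Qed.

Lemma euler_limit_dist r s : t0 <= r -> t0 <= s ->
  `|Z r - Z s| <= K * `|r - s|.
Proof.
move=> t0r t0s; have [rs|/ltW sr] := leP r s.
  rewrite distrC [`|r - s|]distrC (ger0_norm (x := s - r)) ?subr_ge0//.
  exact: euler_limit_lip.
by rewrite (ger0_norm (x := r - s)) ?subr_ge0// euler_limit_lip.
Qed.

(** Squeezes short increments between the slopes [p - e] and [p + e], using both one-sided increment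
    bounds. *)
Lemma euler_limit_deriv t p : t0 <= t ->
  (forall e : R, 0 < e -> exists2 eta : R, 0 < eta & \forall m \near \oo,
    forall tau y, `|tau - t| <= eta -> `|y - Z t| <= eta ->
      `|g m (b tau) y - p| <= e) ->
  deriv_within `[t0, +oo[ Z t p.
Proof.
move=> t0t Hp; apply/deriv_withinP => e e0.
have [eta eta0 Heta] := Hp e e0.
(* [C] exceeds [K + |M|] for both [M = p + e] and [M = p - e]. With [rho = C * d], times within
   [d + rho] of [t] and values within [2 * rho + K * d] of [Z t] stay inside
   [4 * (C + K) * d = eta]. *)
pose C := 1 + K + (K + `|p + e| + `|p - e|).
have C0 : 0 < C by rewrite /C -addrA ltr_pwDl// addr_ge0// !addr_ge0.
pose d := eta / (4 * (C + K)) .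
have d0 : 0 < d by rewrite /d divr_gt0// mulr_gt0// ltr_pwDl.
have dC : 4 * ((C + K) * d) = eta.
  by rewrite /d mulrA mulrCA mulrV ?mulr1// unitfE gt_eqF// mulr_gt0// ltr_pwDl.
exists d => // s; rewrite /= in_itv/= andbT => t0s st.
pose rho := C * d.
have rho0 : 0 < rho by rewrite mulr_gt0.
have Kd0 : 0 <= K * d by rewrite mulr_ge0// ltW.
have d_rho : d <= rho.
  by rewrite /rho ler_peMl ?(ltW d0)// /C -addrA lerDl !addr_ge0.
have Hstep (M r' s' : R) : `|M| <= `|p + e| + `|p - e| -> t0 <= r' ->
    r' <= s' -> s' - r' < d -> (K + `|M|) * (s' - r') < rho.
  move=> HM t0r' rs' srd; apply: le_lt_trans (_ : (K + `|M|) * d < _).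
    by rewrite ler_wpM2l ?addr_ge0// ltW.
  rewrite /rho ltr_pM2r// /C; have := K0; lra.
have near_t r' s' : t0 <= r' -> r' <= s' -> `|r' - t| < d -> `|s' - t| < d ->
    \forall m \near \oo, forall tau y, t0 <= tau -> r' - rho <= tau <= s' ->
     `|y - Z r'| <= 2 * rho -> `|g m (b tau) y - p| <= e.
  move=> t0r' rs' r't s't; apply: filterS Heta => m H tau y t0tau.
  move=> /andP[t1 t2] yr.
  have Zr't : `|Z r' - Z t| <= K * d.
    apply: le_trans (euler_limit_dist t0r' t0t) _.
    by rewrite ler_wpM2l// ltW.
  have r'td : `|r' - t| <= d by exact: ltW.
  have s'td : `|s' - t| <= d by exact: ltW.
  have rhoE : rho = C * d by [].
  by apply: H; move: r'td s'td Zr't yr; rewrite !ler_norml;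
    do 4! [case/andP => ? ?]; apply/andP; split; lra.
(* Stated for an ordered pair near [t], so that [t] can serve as the left or as the right end. *)
have fin r' s' : t0 <= r' -> r' <= s' -> `|r' - t| < d -> `|s' - t| < d ->
    s' - r' < d ->
    `|Z s' - Z r' - p * (s' - r')| <= e * (s' - r').
  move=> t0r' rs' r't s't srd; have nt := near_t r' s' t0r' rs' r't s't.
  have Hup : `|p + e| <= `|p + e| + `|p - e| by rewrite lerDl.
  have Hlo : `|p - e| <= `|p + e| + `|p - e| by rewrite lerDr.
  have H1 : Z s' <= Z r' + (p + e) * (s' - r').
    apply: (euler_limit_le t0r' rs' (Hstep _ _ _ Hup t0r' rs' srd)).
    apply: filterS nt => m H tau y h1 h2 h3; have := H tau y h1 h2 h3.
    by rewrite ler_norml => /andP[]; lra.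
  have H2 : Z r' + (p - e) * (s' - r') <= Z s'.
    apply: (euler_limit_ge t0r' rs' (Hstep _ _ _ Hlo t0r' rs' srd)).
    apply: filterS nt => m H tau y h1 h2 h3; have := H tau y h1 h2 h3.
    by rewrite ler_norml => /andP[]; lra.
  by rewrite ler_norml; apply/andP; split; lra.
have tt : `|t - t| < d by rewrite subrr normr0.
have [ts|/ltW ts] := leP t s.
  have ? : s - t < d by apply: le_lt_trans st; exact: ler_norm.
  by rewrite [X in _ <= e * X]ger0_norm ?subr_ge0//; exact: fin.
have ? : t - s < d by apply: le_lt_trans st; rewrite distrC ler_norm.
rewrite [`|s - t|]distrC [X in _ <= e * X]ger0_norm ?subr_ge0//.
have -> : Z s - Z t - p * (s - t) = - (Z t - Z s - p * (t - s)) by lra.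
by rewrite normrN; exact: fin.
Qed.

End UpperLimit.

(** * Slope bounds for a competing Lipschitz solution *)

Lemma deriv_within_is_derive (R : realType) (D : set R) (X : R -> R) (t l : R) :
  nbhs t D -> deriv_within D X t l -> is_derive t 1 X l.
Proof.
move=> /nbhs_ballP[r /= r0 rD] /deriv_withinP XD.
apply/deriv_withinT/deriv_withinP => e /XD[eta eta0 H].
exists (Num.min eta r); first by rewrite lt_min eta0.
move=> s _; rewrite lt_min => /andP[seta sr].
by apply: H => //; apply: rD; rewrite /ball /= distrC.
Qed.

(** Continuous counterpart of [polygon_le]. If the conclusion fails, the Lipschitz bound from
    [Y r <= c] and from the too large [Y s] keeps [Y] within [rho] of [c] on all of [[r, s]]; there
    the derivative is controlled and the mean value theorem gives a contradiction. *)
Lemma lipschitz_slope_le (R : realType) (Y df : R -> R) (K M c rho r s : R) :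
  r < s ->
  (forall u v, r <= u -> u <= v -> v <= s -> `|Y v - Y u| <= K * (v - u)) ->
  (K + `|M|) * (s - r) <= rho ->
  (forall tau, r < tau < s -> `|Y tau - c| <= rho ->
     is_derive tau 1 Y (df tau) /\ df tau <= M) ->
  Y r <= c -> Y s <= c + M * (s - r).
Proof.
move=> rs Ylip small dY Yr; rewrite leNgt; apply/negP => Ys.
have K0 : 0 <= K.
  have := le_trans (normr_ge0 _) (Ylip r s (lexx _) (ltW rs) (lexx _)).
  by rewrite pmulr_lge0 ?subr_gt0.
have sr0 : 0 <= s - r by rewrite subr_ge0 ltW.
have MN : - `|M| * (s - r) <= M * (s - r).
  by rewrite ler_wpM2r// lerNl -normrN ler_norm.
have N0 : 0 <= `|M| * (s - r) by rewrite mulr_ge0.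
have near_c tau : r <= tau -> tau <= s -> `|Y tau - c| <= rho.
  move=> rt ts; have := Ylip r tau (lexx _) rt ts.
  have := Ylip tau s rt ts (lexx _).
  have : K * (tau - r) <= K * (s - r) by rewrite ler_wpM2l// lerB.
  have : K * (s - tau) <= K * (s - r) by rewrite ler_wpM2l// lerB.
  move: N0 MN small; move: (`|M| : R) => N.
  rewrite !ler_norml => ? ? ? ? ? /andP[? ?] /andP[? ?].
  by apply/andP; split; lra.
have [tau||tau] := @MVT R Y df r s rs.
- rewrite in_itv/= => /andP[rt ts].
  by have [] := dY tau _ (near_c _ (ltW rt) (ltW ts)) => //; rewrite rt.
- apply/subspace_continuousP => x /=; rewrite in_itv/= => /andP[rx xs].
  apply/cvgrPdist_le => e e0; rewrite near_withinE.
  apply/nbhs_ballP; exists (e / (K + 1)) => /=.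
    by rewrite divr_gt0// ltr_pwDr.
  move=> y; rewrite /ball /= in_itv/= ltr_pdivlMr ?ltr_pwDr//.
  move=> xy /andP[ry ys].
  apply: le_trans (ltW xy); rewrite mulrDr mulr1 -[leLHS]addr0 lerD//.
  have [xley|/ltW ylex] := leP x y.
    rewrite distrC [`|x - y|]distrC (ger0_norm (x := y - x)) ?subr_ge0//.
    by rewrite mulrC Ylip.
  by rewrite (ger0_norm (x := x - y)) ?subr_ge0// mulrC Ylip.
- rewrite in_itv/= => /andP[rt ts] YE.
  have [|_ dM] := dY tau _ (near_c _ (ltW rt) (ltW ts)); first by rewrite rt.
  have : df tau * (s - r) <= M * (s - r) by rewrite ler_wpM2r.
  lra.
Qed.

(** * The upper slope field *)

Section Slope.
Context {R : realType}.
Variables (F1 F2 : R -> R) (beta K : R).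
Hypothesis F1_bnd : forall x, `|F1 x| <= beta.
Hypothesis F2_bnd : forall x, `|F2 x| <= beta.
Hypothesis betaK : beta <= K.

(* In the band of width [d] around [b t = y], where the sign of [x - y] is not
   reliable, the slope is the largest one that is allowed. *)
Definition upper_slope (d y x : R) : R :=
  if y + d < x then Num.min K (F1 x + d)
  else if x < y - d then Num.min K (F2 x + d) else K.

Let F1K x : - K <= F1 x <= K.
Proof. by rewrite -ler_norml; apply: le_trans betaK. Qed.

Let F2K x : - K <= F2 x <= K.
Proof. by rewrite -ler_norml; apply: le_trans betaK. Qed.

Let K0 : 0 <= K := le_trans (le_trans (normr_ge0 _) (F1_bnd 0)) betaK.

Let minK d u : 0 <= d -> - K <= u <= K -> u <= Num.min K (u + d) <= u + d.
Proof.
move=> d0 /andP[? uK]; rewrite le_min uK lerDl d0 /= ge_min lexx orbT.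
by [].
Qed.

(** The cap never cuts below [F1 x], because [F1 x <= beta <= K]. *)
Lemma upper_slope_above d y x : 0 <= d -> y + d < x ->
  F1 x <= upper_slope d y x <= F1 x + d.
Proof. by move=> d0 yx; rewrite /upper_slope yx minK. Qed.

Lemma upper_slope_below d y x : 0 <= d -> x < y - d ->
  F2 x <= upper_slope d y x <= F2 x + d.
Proof.
by move=> d0 yx; rewrite /upper_slope ifN ?yx ?minK// -leNgt; lra.
Qed.

Lemma upper_slope_bnd d y x : 0 <= d -> `|upper_slope d y x| <= K.
Proof.
have H u : 0 <= d -> - K <= u <= K -> `|Num.min K (u + d)| <= K.
  move=> d0 uK; have := minK d0 uK; case/andP: uK => ? ? /andP[? _].
  rewrite ler_norml ge_min lexx /= andbT; lra.
move=> d0; rewrite /upper_slope; case: ifP => _; first exact: H.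
by case: ifP => _; [exact: H | rewrite ger0_norm].
Qed.

End Slope.

(** * The limit of the schemes is a solution *)

Section MaximalSolution.
Context {R : realType}.
Variables (F1 F2 : R -> R) (t0 x0 beta K : R).
Hypotheses (F1_cont : continuous F1) (F2_cont : continuous F2).
Hypothesis F1_bnd : forall x, `|F1 x| <= beta.
Hypothesis F2_bnd : forall x, `|F2 x| <= beta.
Hypothesis betaK : beta <= K.

Definition euler_slope (m : nat) : R -> R -> R :=
  upper_slope F1 F2 K m.+1%:R^-1.

Lemma euler_slope_bnd m y x : `|euler_slope m y x| <= K.
Proof. by rewrite (upper_slope_bnd F1_bnd F2_bnd betaK). Qed.

Definition max_solution (b : R -> R) : R -> R :=
  euler_limit euler_slope b t0 x0.

Let K0 : 0 <= K := le_trans (le_trans (normr_ge0 _) (F1_bnd 0)) betaK.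

Variable b : R -> R.
Hypothesis b_cont : continuous b.
Local Notation Z := (max_solution b).

Let slope_near (F : R -> R) (y0 t e gap : R) : continuous F ->
  0 < e -> 0 < gap -> exists2 eta : R, 0 < eta & forall tau y,
  `|tau - t| <= eta -> `|y - y0| <= eta ->
  [/\ `|b tau - b t| <= gap, `|y - y0| <= gap & `|F y - F y0| <= e].
Proof.
move=> F_cont e0 gap0.
have /cvgrPdist_le/(_ _ gap0)/nbhs_ballP[r1 /= r10 H1] := @b_cont t.
have /cvgrPdist_le/(_ _ e0)/nbhs_ballP[r2 /= r20 H2] := F_cont y0.
exists (Num.min gap (Num.min (r1 / 2) (r2 / 2))).
  by rewrite !lt_min gap0 !divr_gt0.
move=> tau y; rewrite !le_min => /and3P[_ t1 _] /and3P[y1 _ y2]; split=> //.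
  rewrite distrC; apply: H1; rewrite /ball /= distrC; lra.
by rewrite distrC; apply: H2; rewrite /ball /= distrC; lra.
Qed.

Lemma max_solution_is_lipschitz_solution :
  is_lipschitz_solution F1 F2 b t0 x0 `[t0, +oo[ K Z.
Proof.
split; last first.
  move=> [r s] /= []; rewrite !in_itv/= !andbT => t0r t0s.
  exact: (euler_limit_dist b x0 euler_slope_bnd t0r t0s).
split; first exact: (euler_limit_start b t0 x0 euler_slope_bnd).
move=> t; rewrite /= in_itv/= andbT => t0t.
have dZ p :=
  @euler_limit_deriv R euler_slope b t0 x0 K euler_slope_bnd t p t0t.
split=> [bZ|Zb]; apply: dZ => e e0; have e20 : 0 < e / 2 by rewrite divr_gt0.
(* A quarter of the distance is allotted to each of the motion of [b], the motion of [y] and the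
   band width, so the band is cleared. Of [e], one half goes to the variation of [F1], the other to
   the margin [m.+1%:R^-1]. *)
- have gap0 : 0 < (Z t - b t) / 4 by rewrite divr_gt0// subr_gt0.
  have [eta eta0 H] := slope_near (Z t) t F1_cont e20 gap0.
  exists eta => //.
  have := near_infty_natSinv_lt (PosNum e20).
  have := near_infty_natSinv_lt (PosNum gap0).
  apply: filterS2 => m /= m1 m2 tau y /H{}H /H[].
  have d0 : 0 <= m.+1%:R^-1 :> R by [].
  have := @upper_slope_above _ F1 F2 beta K F1_bnd betaK _ (b tau) y d0.
  rewrite -/(euler_slope m); move: m1 m2 d0.
  move: (m.+1%:R^-1 : R) => d m1 m2 d0 S.
  rewrite -/(Z t) !ler_norml => /andP[? ?] /andP[? ?] /andP[? ?].
  have /andP[? ?] : F1 y <= euler_slope m (b tau) y <= F1 y + d.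
    by apply: S; lra.
  by apply/andP; split; lra.
- have gap0 : 0 < (b t - Z t) / 4 by rewrite divr_gt0// subr_gt0.
  have [eta eta0 H] := slope_near (Z t) t F2_cont e20 gap0.
  exists eta => //.
  have := near_infty_natSinv_lt (PosNum e20).
  have := near_infty_natSinv_lt (PosNum gap0).
  apply: filterS2 => m /= m1 m2 tau y /H{}H /H[].
  have d0 : 0 <= m.+1%:R^-1 :> R by [].
  have := @upper_slope_below _ F1 F2 beta K F2_bnd betaK _ (b tau) y d0.
  rewrite -/(euler_slope m); move: m1 m2 d0.
  move: (m.+1%:R^-1 : R) => d m1 m2 d0 S.
  rewrite -/(Z t) !ler_norml => /andP[? ?] /andP[? ?] /andP[? ?].
  have /andP[? ?] : F2 y <= euler_slope m (b tau) y <= F2 y + d.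
    by apply: S; lra.
  by apply/andP; split; lra.
Qed.

(** * Comparison with an arbitrary [K]-Lipschitz solution *)

Section Competitor.
Variable Y : R -> R.
Hypothesis Y_sol : is_lipschitz_solution F1 F2 b t0 x0 `[t0, +oo[ K Y.

Let Ylip u v : t0 <= u -> u <= v -> `|Y v - Y u| <= K * (v - u).
Proof.
move=> t0u uv; case: Y_sol => _ /(_ (v, u)) /=.
rewrite !in_itv/= !andbT [`|v - u|]ger0_norm ?subr_ge0//; apply.
by split=> //; apply: le_trans uv.
Qed.

Let Yderiv tau : t0 < tau ->
  (b tau < Y tau -> is_derive tau 1 Y (F1 (Y tau))) /\
  (Y tau < b tau -> is_derive tau 1 Y (F2 (Y tau))).
Proof.
move=> t0tau; have nD : nbhs tau `[t0, +oo[%classic.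
  by apply: filterS (lt_nbhsr t0tau) => y /ltW; rewrite /= in_itv/= andbT.
case: Y_sol => [[_ /(_ tau)]] /=; rewrite in_itv/= andbT ltW//.
move=> /(_ isT)[H1 H2] _.
by split=> [/H1|/H2]; exact: deriv_within_is_derive.
Qed.

Let F1K x : F1 x <= K := le_trans (le_trans (ler_norm _) (F1_bnd x)) betaK.
Let F2K x : F2 x <= K := le_trans (le_trans (ler_norm _) (F2_bnd x)) betaK.

(** Induction over the grid: over one step [Y] starts at or below [x k] and gains at most the slope
    used by the scheme. Off the band, wherever [Y] is near [x k] it lies on the same side of [b],
    and the margin [d] covers the variation of [F1] or [F2]. *)
Lemma euler_ge_solution (d T : R) : 0 < d ->
  \forall n \near \oo, forall k : nat, t0 + n.+1%:R^-1 * k%:R <= T ->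
    Y (t0 + n.+1%:R^-1 * k%:R) <=
    euler (upper_slope F1 F2 K d) b t0 x0 n.+1%:R^-1 k.
Proof.
move=> d0; have d20 : 0 < d / 2 by rewrite divr_gt0.
have [eta eta0 Hb] := continuous_unif t0 T b_cont d20.
(* The scheme moves at most [C] up to time [T], so uniform continuity around [[x0 - C, x0 + C]] is
   enough. *)
pose C := K * (T - t0).
have [eta1 eta10 H1] := continuous_unif (x0 - C) (x0 + C) F1_cont d0.
have [eta2 eta20 H2] := continuous_unif (x0 - C) (x0 + C) F2_cont d0.
have [rho [rho0 rhod rho1 rho2]] :
    exists rho : R, [/\ 0 < rho, rho <= d / 4, rho < eta1 & rho < eta2].
  exists (Num.min (d / 4) (Num.min (eta1 / 2) (eta2 / 2))).
  rewrite !lt_min !divr_gt0// !ge_min lexx !gt_min.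
  by split=> //; apply/orP; right; apply/orP; [left|right]; lra.
have := near_infty_natSinv_lt (PosNum eta0).
have := near_mul_natSinv_le (2 * K) rho0.
apply: filterS2 => n /=.
have : 0 < n.+1%:R^-1 :> R by rewrite invr_gt0.
move: (n.+1%:R^-1 : R) => h h0 hrho heta.
set x := euler _ _ _ _ _; elim=> [|k IH].
  by move=> _; rewrite mulr0 addr0 /=; case: Y_sol => [[->]].
set r := t0 + h * k%:R; have sE : t0 + h * k.+1%:R = r + h.
  by rewrite /r -natr1 mulrDr mulr1 addrA.
rewrite sE => rhT.
have t0r : t0 <= r by rewrite lerDl mulr_ge0// ltW.
have {}IH : Y r <= x k by apply: IH; rewrite -/r; lra.
have xk : x0 - C <= x k <= x0 + C.
  have xb : `|x k - x0| <= K * (h * k%:R).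
    elim: (k) => [|j IHj]; first by rewrite subrr normr0 !mulr0.
    rewrite -(subrKA (x j)); apply: le_trans (ler_normD _ _) _.
    rewrite -natr1 mulrDr mulrDr mulr1 addrC lerD//.
    apply: (euler_step (g := upper_slope F1 F2 K d)) (ltW h0) => y z.
    by apply: (upper_slope_bnd F1_bnd F2_bnd betaK); exact: ltW.
  have : K * (h * k%:R) <= C by rewrite ler_wpM2l// -/r; rewrite /r in rhT; lra.
  by move: xb; rewrite ler_norml => /andP[? ?] ?; apply/andP; split; lra.
set M := upper_slope F1 F2 K d (b r) (x k).
have MK : `|M| <= K by rewrite (upper_slope_bnd F1_bnd F2_bnd betaK)// ltW.
have small : (K + `|M|) * (r + h - r) <= rho.
  rewrite addrAC subrr add0r; apply: le_trans hrho.
  by rewrite ler_wpM2r// ?(ltW h0)//; lra.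
have lip u v : r <= u -> u <= v -> v <= r + h -> `|Y v - Y u| <= K * (v - u).
  by move=> ru uv _; apply: Ylip => //; apply: le_trans ru.
have b_near tau : r < tau < r + h -> `|b r - b tau| < d / 2.
  move=> /andP[rt tr]; apply: Hb; first by rewrite t0r; lra.
  by rewrite distrC gtr0_norm ?subr_gt0//; lra.
have -> : x k.+1 = x k + M * (r + h - r) by rewrite addrAC subrr add0r.
have rrh : r < r + h by lra.
have [above|] := ltP (b r + d) (x k).
  apply: (lipschitz_slope_le (df := F1 \o Y) rrh lip small) => // tau taur Yx.
  have := b_near _ taur; move: (Yx); rewrite ltr_norml ler_norml.
  move=> /andP[? ?] /andP[? ?].
  have [dY _] := @Yderiv tau (le_lt_trans t0r (proj1 (andP taur))).
  split; first by apply: dY; lra.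
  rewrite /M /upper_slope above le_min F1K /=.
  have := H1 _ (Y tau) xk; rewrite distrC => /(_ (le_lt_trans Yx rho1)).
  by rewrite ltr_norml => /andP[? ?]; lra.
move=> nabove; have [below|nbelow] := ltP (x k) (b r - d).
  apply: (lipschitz_slope_le (df := F2 \o Y) rrh lip small) => // tau taur Yx.
  have := b_near _ taur; move: (Yx); rewrite ltr_norml ler_norml.
  move=> /andP[? ?] /andP[? ?].
  have [_ dY] := @Yderiv tau (le_lt_trans t0r (proj1 (andP taur))).
  split; first by apply: dY; lra.
  rewrite /M /upper_slope ltNge nabove /= below le_min F2K /=.
  have := H2 _ (Y tau) xk; rewrite distrC => /(_ (le_lt_trans Yx rho2)).
  by rewrite ltr_norml => /andP[? ?]; lra.
(* In the band the scheme climbs with slope [K], the most that a [K]-Lipschitz competitor can do. *)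
have := Ylip t0r (ltW rrh); rewrite ler_norml => /andP[_].
rewrite /M /upper_slope ltNge nabove /= ltNge nbelow /=; lra.
Qed.

Lemma solution_le_max_solution t : t0 <= t -> Y t <= Z t.
Proof.
move=> t0t; apply/ler_addgt0Pr => /= e e0.
have e20 : 0 < e / 2 by rewrite divr_gt0.
have Zlt : Z t < Z t + e / 2 by rewrite ltrDl.
have bnd m n : euler_at (euler_slope m) b t0 x0 n t <= x0 + (K * (t - t0) + K).
  have := euler_at_bnd b x0 euler_slope_bnd m n t0t.
  by rewrite ler_norml => /andP[_]; lra.
(* First one [m] is fixed, then [n] is taken large depending on it: the mesh needed in
   [euler_ge_solution] depends on the band width, which is why the limit is iterated. *)
have /filter_ex[m Em] := near_le_dlimsup bnd Zlt.
have d0 : 0 < m.+1%:R^-1 :> R by rewrite invr_gt0.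
suff : \forall n \near \oo, Y t <= Z t + e by case/filter_ex.
move: Em (euler_ge_solution t d0) (near_mul_natSinv_le K e20).
apply: filterS3 => n En Yn Kn.
have /andP[k1 k2] := grid_index_itv n t0t.
have := Yn _ k1; rewrite -/(euler_slope m) -/(euler_at _ _ _ _ _ _) => Yk.
set u := t0 + _ in k1 k2 Yk.
have t0u : t0 <= u by rewrite lerDl mulr_ge0.
have := Ylip t0u k1; rewrite ler_norml => /andP[_ ?].
have : K * (t - u) <= K * n.+1%:R^-1 by rewrite ler_wpM2l// lerBlDl ltW.
by move: Kn En Yk; move: (K * _^-1) (euler_at _ _ _ _ _ _) => ? ?; lra.
Qed.

End Competitor.

Lemma max_solution_is_maximal :
  is_maximal_lipschitz_solution F1 F2 b t0 x0 K Z.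
Proof.
split; first exact: max_solution_is_lipschitz_solution.
by move=> Y HY t; exact: solution_le_max_solution.
Qed.

End MaximalSolution.

(** * Time reversal and gluing at [t0] *)

(** Reflecting time about [t0] changes the sign of the derivative, hence [- F1] and [- F2]. At [t0]
    both halves take the value [x0], so they fall under the same case of the equation and their
    one-sided derivatives match. *)
Lemma glue_reflected_solution (R : realType) (F1 F2 b Xp Xm : R -> R)
    (t0 x0 K : R) :
  is_lipschitz_solution F1 F2 b t0 x0 `[t0, +oo[ K Xp ->
  is_lipschitz_solution (fun x => - F1 x) (fun x => - F2 x)
    (fun t => b (2 * t0 - t)) t0 x0 `[t0, +oo[ K Xm ->
  is_lipschitz_solution F1 F2 b t0 x0 setT K
    (fun t => if t0 <= t then Xp t else Xm (2 * t0 - t)).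
Proof.
move=> [[Xp0 Xpd] Xpl] [[Xm0 Xmd] Xml]; set X := (fun t => _).
have Xr t : t0 <= t -> X t = Xp t by rewrite /X => ->.
have Xl t : t <= t0 -> X t = Xm (2 * t0 - t).
  rewrite /X => tt0; case: (leP t0 t) => // t0t; have -> : t = t0 by lra.
  have -> : 2 * t0 - t0 = t0 by lra.
  by rewrite Xm0 Xp0.
have dX t l : (t0 <= t -> deriv_within `[t0, +oo[ Xp t l) ->
    (t <= t0 -> deriv_within `[t0, +oo[ Xm (2 * t0 - t) (- l)) ->
    deriv_within setT X t l.
  move=> dXp dXm; apply/deriv_withinP => e e0.
  (* Each half estimates increments on its own side of [t0] and is vacuous when [t] is on the other
     side; both are needed only at [t = t0]. *)
  have rhs : exists2 eta : R, 0 < eta & forall s, t0 <= t -> t0 <= s ->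
      `|s - t| < eta -> `|X s - X t - l * (s - t)| <= e * `|s - t|.
    have [t0t|tt0] := leP t0 t; last by exists 1.
    have /deriv_withinP/(_ e e0)[eta eta0 H] := dXp t0t.
    exists eta => // s _ t0s st; rewrite !Xr//; apply: H => //.
    by rewrite /= in_itv/= t0s.
  have lhs : exists2 eta : R, 0 < eta & forall s, t <= t0 -> s <= t0 ->
      `|s - t| < eta -> `|X s - X t - l * (s - t)| <= e * `|s - t|.
    have [tt0|t0t] := leP t t0; last by exists 1.
    have /deriv_withinP/(_ e e0)[eta eta0 H] := dXm tt0.
    exists eta => // s _ st0 st; rewrite !Xl//.
    have E : 2 * t0 - s - (2 * t0 - t) = - (s - t) by lra.
    have := H (2 * t0 - s); rewrite E normrN mulrNN; apply => //.
    by rewrite /= in_itv/= andbT; lra.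
  have [[eta1 eta10 H1] [eta2 eta20 H2]] := (rhs, lhs).
  have [tt0|t0t|tE] := ltgtP t t0.
  - exists (Num.min eta2 (t0 - t)); first by rewrite lt_min eta20 subr_gt0.
    move=> s _; rewrite lt_min => /andP[s1 s2].
    apply: H2 => //; first exact: ltW.
    by move: s2; rewrite ltr_norml => /andP[]; lra.
  - exists (Num.min eta1 (t - t0)); first by rewrite lt_min eta10 subr_gt0.
    move=> s _; rewrite lt_min => /andP[s1 s2].
    apply: H1 => //; first exact: ltW.
    by move: s2; rewrite ltr_norml => /andP[]; lra.
  - exists (Num.min eta1 eta2); first by rewrite lt_min eta10.
    move=> s _; rewrite lt_min => /andP[s1 s2].
    have [?|?] := leP t0 s; [apply: H1 => //|apply: H2 => //; last exact: ltW];
      by rewrite tE.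
have inD t : (`[t0, +oo[%classic : set R) t <-> t0 <= t.
  by rewrite /= in_itv/= andbT.
split.
  split; first by rewrite Xr.
  move=> t _; split=> bX; apply: dX => ht.
  - by rewrite Xr// in bX *; have [H _] := Xpd t (proj2 (inD t) ht); exact: H.
  - have ht' : t0 <= 2 * t0 - t by lra.
    have E : 2 * t0 - (2 * t0 - t) = t by lra.
    rewrite Xl// in bX *; have [] := Xmd _ (proj2 (inD _) ht').
    by rewrite E => H _; exact: H.
  - by rewrite Xr// in bX *; have [_ H] := Xpd t (proj2 (inD t) ht); exact: H.
  - have ht' : t0 <= 2 * t0 - t by lra.
    have E : 2 * t0 - (2 * t0 - t) = t by lra.
    rewrite Xl// in bX *; have [] := Xmd _ (proj2 (inD _) ht').
    by rewrite E => _ H; exact: H.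
have lr r s : t0 <= r -> t0 <= s -> `|X r - X s| <= K * `|r - s|.
  move=> t0r t0s; rewrite !Xr//.
  by apply: (Xpl (r, s)); split; apply/inD.
have ll r s : r <= t0 -> s <= t0 -> `|X r - X s| <= K * `|r - s|.
  move=> t0r t0s; rewrite !Xl//.
  have -> : `|r - s| = `|(2 * t0 - r) - (2 * t0 - s)|.
    by rewrite -normrN; congr `|_|; lra.
  by apply: (Xml (2 * t0 - r, 2 * t0 - s)); split; apply/inD => /=; lra.
have lm r s : r <= t0 -> t0 <= s -> `|X r - X s| <= K * `|r - s|.
  move=> rt0 t0s; rewrite -(subrKA (X t0)).
  apply: le_trans (ler_normD _ _) _.
  apply: le_trans (lerD (ll _ _ rt0 (lexx _)) (lr _ _ (lexx _) t0s)) _.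
  rewrite !ler0_norm ?subr_le0//; last exact: le_trans t0s.
  by have -> : K * - (r - t0) + K * - (t0 - s) = K * - (r - s) by lra.
move=> [r s] _ /=.
have [rt0|/ltW t0r] := leP r t0; have [st0|/ltW t0s] := leP s t0.
- exact: ll.
- exact: lm.
- by rewrite distrC [`|r - s|]distrC; exact: lm.
- exact: lr.
Qed.

(** * Measurability of the limit in the outcome *)

Section Measurability.
Context d (T : measurableType d) (R : realType).

(** Lying strictly below [a] means that some [a - j.+1%:R^-1] is an eventual bound, and eventual
    statements over integers are countable unions of countable intersections. *)
Lemma measurable_dlimsup (u : nat -> nat -> T -> R) (L U : R) :
  (forall m n w, L <= u m n w <= U) ->
  (forall m n, measurable_fun setT (u m n)) ->
  measurable_fun setT (fun w => dlimsup (fun m n => u m n w)).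
Proof.
move=> uLU mu; apply: (measurability _ (RGenInftyO.measurableE R)).
move=> _ [_ [a ->] <-].
have -> : setT `&` (fun w => dlimsup (fun m n => u m n w)) @^-1` `]-oo, a[ =
  \bigcup_j \bigcup_N \bigcap_(m in [set m | (N <= m)%N])
  \bigcup_N' \bigcap_(n in [set n | (N' <= n)%N])
    [set w | u m n w <= a - j.+1%:R^-1].
  rewrite setTI; apply/seteqP; split=> w /=.
    rewrite in_itv/= => wa.
    have e0 : 0 < a - dlimsup (fun m n => u m n w) by rewrite subr_gt0.
    have /filter_ex[j /= ja] := near_infty_natSinv_lt (PosNum e0).
    have uU m n : u m n w <= U by case/andP: (uLU m n w).
    rewrite ltrBrDl -ltrBrDr in ja.
    have [N _ HN] := near_le_dlimsup uU ja.
    by exists j => //; exists N.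
  move=> [j _ [N _ HN]]; rewrite in_itv/=.
  apply: (@le_lt_trans _ _ (a - j.+1%:R^-1)); last by rewrite gtrBl invr_gt0.
  apply: (@dlimsup_le _ _ L) => [m n|]; first by case/andP: (uLU m n w).
  by exists N.
apply: bigcup_measurable => j _; apply: bigcup_measurable => N _.
apply: bigcap_measurableType => m _; apply: bigcup_measurable => N' _.
apply: bigcap_measurableType => n _.
have := measurable_fun_ler (mu m n) (measurable_cst (a - j.+1%:R^-1)).
by move=> /(_ measurableT [set true]); rewrite setTI; apply.
Qed.

(** Step [k.+1] reads [b] at grid index [k], so the values up to index [N] involve only the indices
    below [N]. *)
Lemma measurable_euler (g : R -> R -> R) (b : R -> T -> R)
    (t0 x0 h : R) (N : nat) :
  (forall u v : T -> R, measurable_fun setT u -> measurable_fun setT v ->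
     measurable_fun setT (fun w => g (u w) (v w))) ->
  (forall k, (k < N)%N -> measurable_fun setT (b (t0 + h * k%:R))) ->
  forall k, (k <= N)%N ->
    measurable_fun setT (fun w => euler g (b ^~ w) t0 x0 h k).
Proof.
move=> mg mb; elim=> [|k IH] kN; first exact: measurable_cst.
apply: measurable_funD; first exact: IH (ltnW kN).
by apply: measurable_funM => //; apply: mg; [exact: mb | exact: IH (ltnW kN)].
Qed.

Lemma measurable_upper_slope (F1 F2 : R -> R) (K d' : R) (u v : T -> R) :
  continuous F1 -> continuous F2 ->
  measurable_fun setT u -> measurable_fun setT v ->
  measurable_fun setT (fun w => upper_slope F1 F2 K d' (u w) (v w)).
Proof.
move=> /continuous_measurable_fun mF1 /continuous_measurable_fun mF2 mu mv.
apply: measurable_fun_ifT.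
- by apply: measurable_fun_ltr => //; exact: measurable_funD.
- apply: measurable_minr => //; apply: measurable_funD => //.
  exact: measurableT_comp.
apply: measurable_fun_ifT => //.
- by apply: measurable_fun_ltr => //; exact: measurable_funB.
apply: measurable_minr => //; apply: measurable_funD => //.
exact: measurableT_comp.
Qed.

End Measurability.

(** The sigma-algebra on [T] is left arbitrary so that the one generated by the path up to time [t]
    can be put in. The bounds on the schemes hold for every outcome, so no null set is removed. *)
Lemma measurable_max_solution d (T : measurableType d) (R : realType)
    (F1 F2 : R -> R) (t0 x0 beta K t : R) (b : R -> T -> R) :
  continuous F1 -> continuous F2 ->
  (forall x, `|F1 x| <= beta) -> (forall x, `|F2 x| <= beta) -> beta <= K ->
  t0 <= t -> (forall s, t0 <= s <= t -> measurable_fun setT (b s)) ->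
  measurable_fun setT (fun w => max_solution F1 F2 t0 x0 K (b ^~ w) t).
Proof.
move=> cF1 cF2 F1_bnd F2_bnd betaK t0t mb.
apply: (@measurable_dlimsup _ _ _ _ (x0 - (K * (t - t0) + K))
  (x0 + (K * (t - t0) + K))) => [m n w|m n].
  have := euler_at_bnd (b ^~ w) x0 (euler_slope_bnd F1_bnd F2_bnd betaK)
    m n t0t.
  by rewrite ler_norml => /andP[? ?]; apply/andP; split; lra.
apply: (@measurable_euler _ _ _ _ b t0 x0 _ (grid_index t0 n t)) => //.
  by move=> u v mu mv; exact: measurable_upper_slope.
move=> k kN; apply: mb; rewrite lerDl mulr_ge0//=.
have /andP[+ _] := grid_index_itv n t0t; apply: le_trans.
by rewrite lerD2l ler_wpM2l// ler_nat ltnW.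
Qed.

(** * Existence, maximality and adaptedness *)

Unset Implicit Arguments.

Theorem theorem2p2 (R : realType) (d : measure_display) (T : measurableType d)
    (P : probability T R) (t0 x0 beta : R) (F1 F2 : R -> R)
    (F1_cont : continuous F1) (F2_cont : continuous F2)
    (F1_bnd : forall x, `|F1 x| <= beta) (F2_bnd : forall x, `|F2 x| <= beta)
    (B : R -> {RV P >-> R})
    (B_cont : {ae P, forall w, continuous (fun t : R => B t w)}) :
  {ae P, forall w, exists X : R -> R,
     is_lipschitz_solution F1 F2 (fun t => B t w) t0 x0 setT beta X} /\
  (forall K : R, beta <= K ->
     exists Xplus : R -> T -> R,
       {ae P, forall w,
          is_maximal_lipschitz_solution F1 F2 (fun t => B t w) t0 x0 K
            (fun t => Xplus t w)} /\
       adapted_from t0 (natural_filtration (fun t => B t : T -> R) t0) Xplus).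
Proof.
split=> [|K betaK].
  move: B_cont; apply: filterS => w Bw.
  have NF1 x : `|- F1 x| <= beta by rewrite normrN.
  have NF2 x : `|- F2 x| <= beta by rewrite normrN.
  have cNF1 : continuous (fun x => - F1 x) by move=> x; exact: cvgN (F1_cont x).
  have cNF2 : continuous (fun x => - F2 x) by move=> x; exact: cvgN (F2_cont x).
  have cB : continuous (fun t => B (2 * t0 - t) w).
    move=> t; apply: (continuous_comp (f := fun t => 2 * t0 - t) (g := B ^~ w)).
      by apply: cvgB; [exact: cvg_cst | exact: cvg_id].
    exact: Bw.
  (* Both halves are maximal solutions built with [K = beta], the second one for the reversed
     data. *)
  eexists; apply: glue_reflected_solution.
    exact: (max_solution_is_lipschitz_solution t0 x0 F1_cont F2_cont
      F1_bnd F2_bnd (lexx _) Bw).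
  exact: (max_solution_is_lipschitz_solution t0 x0 cNF1 cNF2
    NF1 NF2 (lexx _) cB).
exists (fun t w => max_solution F1 F2 t0 x0 K (B ^~ w) t); split.
  move: B_cont; apply: filterS => w Bw.
  exact: (max_solution_is_maximal t0 x0 F1_cont F2_cont
    F1_bnd F2_bnd betaK Bw).
move=> t t0t U mU.
pose G := \bigcup_(s in `[t0, t]) preimage_set_system setT (B s) measurable.
(* The same functions are viewed on [T] equipped with the sigma-algebra generated by [G], for which
   they are measurable by construction. *)
have mB s : t0 <= s <= t ->
    measurable_fun setT (B s : g_sigma_algebraType G -> R).
  move=> st _ V mV; apply: sub_sigma_algebra.
  exists s; first by rewrite /= in_itv.
  by exists V.
have := @measurable_max_solution _ (g_sigma_algebraType G) R F1 F2 t0 x0 beta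
  K t (fun s => B s) F1_cont F2_cont F1_bnd F2_bnd betaK t0t mB.
by move=> /(_ measurableT U mU); rewrite setTI.
Qed.
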